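(* Let $\{\eta_m\}_{m=1}^\infty$ be a positive, increasing sequence such that $\lim_{m\to\infty}\eta_m=+\infty$ and suppose $\{G(m)\}_{m=1}^\infty\subseteq\mathcal M_{N,K}$ is a sequence of Gram matrices such that, for every $m\in\{1,2,3,\dots\}$, $\Phi_{sum}^{\eta_m}$ achieves its absolute minimum over $\mathcal M_{N,K}$ at $G(m)$ and $G(m)$ corresponds to an equal-norm frame. Then there exist a subsequence $\{G(m_s)\}_{s=1}^\infty$ and $G\in\mathcal M_{N,K}$ such that $\lim_{s\to\infty}G(m_s)=G$, where $G$ is the Gramian of a Grassmannian equal-norm Parseval frame.
   Context: Let $\mathbb F=\mathbb R$ or $\mathbb C$, and let $K,N$ be integers with $1\le K\le N$, $N\ge2$. $\mathcal M_{N,K}=\{G\in\mathbb F^{N\times N}: G=G^2=G^*,\ \mathrm{tr}(G)=K\}$ is precisely the set of Gram matrices of $(N,K)$-frames, i.e. Parseval frames of $N$ vectors for $\mathbb F^K$; the frame is equal-norm iff all diagonal entries of $G$ are equal (to $K/N$). $C_{N,K}=\sqrt{\frac{K(N-K)}{N^2(N-1)}}$. The sum potential is $\Phi_{sum}^\eta(G)=\sum_{j\ne l}e^{\eta|G_{j,l}|^2}+\sum_{j=1}^N e^{-\eta(K^2/N^2-C_{N,K}^2)}e^{\eta|G_{j,j}|^2}$. Let $\mu(G)=\max_{j\ne l}|G_{j,l}|$. A Grassmannian equal-norm Parseval frame is an equal-norm $(N,K)$-frame whose Gramian $G$ satisfies $\mu(G)=\min\{\mu(G'):G'\in\mathcal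 M_{N,K},\ G'_{j,j}=K/N\text{ for all }j\}$. *)

(* Defs.v *)
From mathcomp Require Import all_boot all_order all_algebra.
From mathcomp Require Import complex.
From mathcomp Require Import all_classical all_reals all_analysis.

Set Implicit Arguments.
Unset Strict Implicit.
Unset Printing Implicit Defensive.

Import Order.TTheory GRing.Theory Num.Theory.
Import numFieldNormedType.Exports.

Local Open Scope classical_set_scope.
Local Open Scope ring_scope.

Inductive scalar_kind := RealScalars | ComplexScalars.

(* The field F of the frames: R itself or R[i].  Its topology, and that of the
   matrices over it, is the canonical one of a numFieldType. *)
Definition frame_field (R : realType) (k : scalar_kind) : numFieldType :=
  match k with
  | RealScalars => R
  | ComplexScalars => R[i]%C
  end.

Definition conj_field (R : realType) (k : scalar_kind) :
    frame_field R k -> frame_field R k :=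
  match k return frame_field R k -> frame_field R k with
  | RealScalars => fun x => x
  | ComplexScalars => fun z : R[i]%C => z^*
  end.

(* The modulus as an element of R: the norm `|z| of z : R[i] lives in R[i]. *)
Definition modulus (R : realType) (k : scalar_kind) : frame_field R k -> R :=
  match k return frame_field R k -> R with
  | RealScalars => fun x : R => `|x|
  | ComplexScalars => fun z : R[i]%C => complex.Re `|z|
  end.

Section Frames.
Variables (R : realType) (k : scalar_kind).
Local Notation F := (frame_field R k).

Definition adjoint (m n : nat) (A : 'M[F]_(m, n)) : 'M[F]_(n, m) :=
  map_mx (@conj_field R k) A^T.

Definition inner (K : nat) (x y : 'cV[F]_K) : F :=
  \sum_(a < K) x a 0 * conj_field (y a 0).

Definition vnorm (K : nat) (x : 'cV[F]_K) : R :=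
  Num.sqrt (\sum_(a < K) modulus (x a 0) ^+ 2).

(* (N,K)-frame: Parseval frame of N vectors for F^K *)
Definition parseval_frame (N K : nat) (f : 'I_N -> 'cV[F]_K) : Prop :=
  forall x : 'cV[F]_K,
    \sum_(j < N) modulus (inner x (f j)) ^+ 2 = vnorm x ^+ 2.

Definition equal_norm (N K : nat) (f : 'I_N -> 'cV[F]_K) : Prop :=
  forall j l : 'I_N, vnorm (f j) = vnorm (f l).

Definition gramian (N K : nat) (f : 'I_N -> 'cV[F]_K) : 'M[F]_N :=
  \matrix_(j, l) inner (f l) (f j).

Definition gram_set (N K : nat) : set 'M[F]_N :=
  [set G | [/\ G = G *m G, G = adjoint G & \tr G = K%:R]].
Arguments gram_set : clear implicits.

Definition frame_const (N K : nat) : R :=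
  Num.sqrt ((K%:R * (N%:R - K%:R)) / (N%:R ^+ 2 * (N%:R - 1))).

Definition sum_potential (N K : nat) (eta : R) (G : 'M[F]_N) : R :=
  \sum_(j < N) \sum_(l < N | j != l) expR (eta * modulus (G j l) ^+ 2)
  + \sum_(j < N)
      expR (- (eta * (K%:R ^+ 2 / N%:R ^+ 2 - frame_const N K ^+ 2)))
      * expR (eta * modulus (G j j) ^+ 2).

(* The default value 0 is harmless: the entries are nonnegative, and there are
   off-diagonal ones as soon as 2 <= N. *)
Definition coherence (N : nat) (G : 'M[F]_N) : R :=
  \big[Num.max/0]_(p : 'I_N * 'I_N | p.1 != p.2) modulus (G p.1 p.2).

Definition equal_norm_gram_set (N K : nat) : set 'M[F]_N :=
  [set G | gram_set N K G /\ forall j : 'I_N, G j j = K%:R / N%:R].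
Arguments equal_norm_gram_set : clear implicits.

Definition attains_min (T : Type) (phi : T -> R) (A : set T) (x : T) : Prop :=
  A x /\ forall y, A y -> phi x <= phi y.

Definition is_minimum (A : set R) (c : R) : Prop := A c /\ lbound A c.

Definition grassmannian_equal_norm_parseval (N K : nat)
    (f : 'I_N -> 'cV[F]_K) : Prop :=
  [/\ parseval_frame f, equal_norm f &
      is_minimum (@coherence N @` equal_norm_gram_set N K)
                 (coherence (gramian f))].

End Frames.

Arguments gram_set {R} k N K _.
Arguments equal_norm_gram_set {R} k N K _.

(* Main.v *)
Require Import Defs.
From mathcomp Require Import all_boot all_order all_algebra.
From mathcomp Require Import complex.
From mathcomp Require Import all_classical all_reals all_analysis.

Import Order.TTheory GRing.Theory Num.Theory.
Import numFieldNormedType.Exports.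

Local Open Scope classical_set_scope.
Local Open Scope ring_scope.

(** All the [G m] share the diagonal [K / N], as their frames are equal-norm and
    their trace is [K].  Hence the frames [f m] satisfy
    [vnorm (f m j) ^+ 2 = K / N] and their finitely many coordinates are
    bounded: by [bounded_family_cvg_subseq] a subsequence of the [f m]
    themselves converges, to [f0] say.  Extracting the limit from the frames
    and not from the Gram matrices spares a factorisation of the limit
    projection: being Parseval and equal-norm are closed conditions
    ([parseval_frame_lim], [equal_norm_lim]), and [gramian] is continuous
    ([cvg_gramian]), so [gramian f0] is the limit sought.

    It remains to see that [gramian f0] has the least coherence
    ([coherence_lim_min]).  Suppose that an equal-norm competitor [H] has
    coherence [a] and that some off-diagonal entry of the limit has modulus
    greater than [a]; fix [b] strictly between.  From some rank on, the same
    entry of [G (ms s)] exceeds [b].  In the comparison of the potentials of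
    [G (ms s)] and [H] the diagonal terms are equal and cancel, leaving
    [expR (eta * b ^+ 2) <= N ^ 2 * expR (eta * a ^+ 2)]
    ([sum_potential_entry_le]), which fails once [eta] is large. *)

(** * The modulus and the topology of the scalar field *)

Lemma modulus_complexE (R : realType) (z : R[i]%C) :
  @modulus R ComplexScalars z =
    Num.sqrt (complex.Re z ^+ 2 + complex.Im z ^+ 2).
Proof. by rewrite /modulus normc_def. Qed.

Section Scalars.
Context {R : realType} {k : scalar_kind}.
Local Notation F := (frame_field R k).
Implicit Types x y z : F.

Lemma modulus_ge0 x : 0 <= modulus x.
Proof.
case: k x => x //=; have := normr_ge0 x.
by rewrite lecE => /andP[].
Qed.

Lemma ler_modulusD x y : modulus (x + y) <= modulus x + modulus y.
Proof.
case: k x y => x y /=; first exact: ler_normD.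
by have := ler_normD x y; rewrite lecE raddfD => /andP[].
Qed.

Lemma modulusN x : modulus (- x) = modulus x.
Proof. by case: k x => x; [|congr complex.Re]; exact: normrN. Qed.

Lemma modulus_conj x : modulus (conj_field x) = modulus x.
Proof. by case: k x => [//|[a b]]; rewrite !modulus_complexE /= sqrrN. Qed.

Lemma conj_fieldB x y : conj_field (x - y) = conj_field x - conj_field y.
Proof. by case: k x y => x y //=; rewrite raddfB. Qed.

Lemma modulus_dist x y : `|modulus x - modulus y| <= modulus (x - y).
Proof.
rewrite ler_norml lerNl opprB !lerBlDr; apply/andP; split.
  by rewrite -(modulusN (x - y)) opprB (le_trans _ (ler_modulusD _ _)) ?subrK.
by rewrite (le_trans _ (ler_modulusD _ _)) ?subrK.
Qed.

(** In the complex case the radii of balls are positive elements of [R[i]];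
    these are exactly the positive reals, so radii in [R] suffice. *)
Lemma cvg_modulusP (u : nat -> F) (l : F) :
  u @ \oo --> l <->
  forall e : R, 0 < e -> \forall n \near \oo, modulus (l - u n) < e.
Proof.
case: k u l => u l; first exact: (@cvgrPdist_lt _ R^o).
have normE (z : R[i]%C) : `|z| = (complex.Re `|z|)%:C%C by rewrite normc_def.
split=> [/cvgrPdist_lt ul e e0|ul].
  have eC0 : 0 < e%:C%C by rewrite ltcE /= eqxx.
  by near=> n; rewrite /= -ltcR -normE; near: n; exact: ul.
apply/(@cvgrPdist_lt _ R[i]%C^o) => eps; rewrite ltcE => /andP[/eqP /= im0 e0].
have -> : eps = (complex.Re eps)%:C%C.
  by case: eps im0 {e0} => a b /= ->.
by near=> n; rewrite normE ltcR; near: n; exact: ul.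
Unshelve. all: by end_near. Qed.

Lemma cvg_modulus (u : nat -> F) (l : F) :
  u @ \oo --> l -> modulus (u n) @[n --> \oo] --> modulus l.
Proof.
move=> /cvg_modulusP ul; apply/cvgrPdist_lt => e e0; near=> n.
by apply: le_lt_trans (modulus_dist _ _) _; near: n; exact: ul.
Unshelve. all: by end_near. Qed.

Lemma cvg_conj_field (u : nat -> F) (l : F) :
  u @ \oo --> l -> conj_field (u n) @[n --> \oo] --> conj_field l.
Proof.
move=> /cvg_modulusP ul; apply/cvg_modulusP => e /ul.
by apply: filterS => n; rewrite -conj_fieldB modulus_conj.
Qed.

End Scalars.

Lemma cvg_fsum (K : numFieldType) (I : finType) (u : I -> nat -> K)
    (l : I -> K) :
  (forall i, u i @ \oo --> l i) ->
  (\sum_i u i n) @[n --> \oo] --> \sum_i l i.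
Proof. by move=> ul; apply: cvg_big => // x; exact: (@add_continuous K^o). Qed.

Lemma cvg_mx (T : topologicalType) (m n : nat) (u : nat -> 'M[T]_(m, n))
    (l : 'M[T]_(m, n)) :
  (forall i j, u s i j @[s --> \oo] --> l i j) -> u @ \oo --> l.
Proof.
move=> ul A [P lP PA]; rewrite /nbhs /=.
have : \forall s \near \oo, forall p : 'I_m * 'I_n, P p.1 p.2 (u s p.1 p.2).
  by apply: filter_forall => -[i j] /=; apply: ul; exact: lP.
by apply: filterS => s Ps; apply: PA => i j; exact: (Ps (i, j)).
Qed.

Lemma cvg_unique_eq (K : numFieldType) (u v : nat -> K) (a b : K) :
  (forall n, u n = v n) -> u @ \oo --> a -> v @ \oo --> b -> a = b.
Proof.
by move=> /funext -> va vb; exact: (@norm_cvg_unique _ K^o _ _ _ _ va vb).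
Qed.

(** * Extraction of convergent subsequences *)

Lemma cvg_increasing_seq (f : nat -> nat) : increasing_seq f -> f @ \oo --> \oo.
Proof.
move=> finc A [N _ NA]; exists N => // n /= Nn; apply: NA => /=.
suff : (n <= f n)%N by exact: leq_trans.
elim: n {Nn} => // n IHn; apply: leq_ltn_trans IHn _.
by rewrite ltnNge -leEnat finc -ltnNge.
Qed.

Lemma cvg_subseq (T : topologicalType) (u : nat -> T) (l : T) (f : nat -> nat) :
  increasing_seq f -> u @ \oo --> l -> (u \o f) @ \oo --> l.
Proof.
by move=> /cvg_increasing_seq finf ul; exact: (cvg_comp f u finf ul).
Qed.

Lemma increasing_comp (f g : nat -> nat) :
  increasing_seq f -> increasing_seq g -> increasing_seq (f \o g).
Proof. by move=> fi gi m n; rewrite /= fi; exact: gi. Qed.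

Lemma bounded_real_cvg_subseq (R : realType) (u : nat -> R) (M : R) :
  (forall n, `|u n| <= M) ->
  exists2 f, increasing_seq f & exists l : R, (u \o f) @ \oo --> l.
Proof.
move=> uM; have /bolzano_weierstrass[f fi /cvg_ex[l fl]] : bounded_fun u.
  exists M; split; first exact: num_real.
  by move=> x /ltW Mx n _ /=; exact: le_trans (uM n) Mx.
by exists f => //; exists l.
Qed.

Section Compactness.
Context {R : realType} {k : scalar_kind}.
Local Notation F := (frame_field R k).

(** Over [R[i]] the real and the imaginary parts are bounded by the modulus, and
    the real case is used for each in turn. *)
Lemma bounded_scalar_cvg_subseq (u : nat -> F) (M : R) :
  (forall n, modulus (u n) <= M) ->
  exists2 f, increasing_seq f & exists l : F, (u \o f) @ \oo --> l.
Proof.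
case: k u => u uM; first exact: bounded_real_cvg_subseq uM.
have ReImM (z : R[i]%C) :
    `|complex.Re z| <= @modulus R ComplexScalars z /\
    `|complex.Im z| <= @modulus R ComplexScalars z.
  rewrite modulus_complexE -!sqrtr_sqr.
  by split; rewrite ler_wsqrtr// ?lerDl ?lerDr sqr_ge0.
have [f fi [a fa]] : exists2 f, increasing_seq f &
    exists a : R, ((fun n => complex.Re (u n)) \o f) @ \oo --> a.
  apply: (@bounded_real_cvg_subseq _ _ M) => n.
  exact: le_trans (ReImM _).1 (uM n).
have [g gi [b gb]] : exists2 g, increasing_seq g &
    exists b : R, ((fun n => complex.Im (u (f n))) \o g) @ \oo --> b.
  apply: (@bounded_real_cvg_subseq _ _ M) => n.
  exact: le_trans (ReImM _).2 (uM (f n)).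
exists (f \o g); first exact: increasing_comp.
exists (a +i* b)%C; apply/cvg_modulusP => e e0.
have {}fa : complex.Re (u (f (g n))) @[n --> \oo] --> a.
  exact: (cvg_subseq _ _ _ _ gi fa).
have e20 : 0 < e / 2 by rewrite divr_gt0.
move/cvgrPdist_lt : fa => /(_ _ e20) fa.
move/cvgrPdist_lt : gb => /(_ _ e20) gb.
near=> n.
have mod_le (x y : R) : @modulus R ComplexScalars (x +i* y)%C <= `|x| + `|y|.
  rewrite modulus_complexE /= -[leRHS]ger0_norm ?addr_ge0// -sqrtr_sqr.
  rewrite ler_wsqrtr// sqrrD !real_normK ?num_real//.
  by rewrite [leRHS]addrAC lerDl mulrn_wge0// mulr_ge0.
rewrite (_ : _ - _ = ((a - complex.Re (u (f (g n)))) +i*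
                      (b - complex.Im (u (f (g n)))))%C).
  rewrite (le_lt_trans (mod_le _ _))// [e]splitr ltrD//.
    by near: n.
  by near: n.
by rewrite /=; case: (u _).
Unshelve. all: by end_near. Qed.

Lemma bounded_family_cvg_subseq (I : finType) (u : nat -> I -> F) (M : R) :
  (forall n i, modulus (u n i) <= M) ->
  exists2 f, increasing_seq f &
    exists l : I -> F, forall i, u (f n) i @[n --> \oo] --> l i.
Proof.
move=> uM.
(* One index at a time: a further extraction preserves the limits already
   obtained. *)
suff [f fi fl] : exists2 f, increasing_seq f & forall i, i \in enum I ->
    exists l : F, u (f n) i @[n --> \oo] --> l.
  exists f => //; have [i|l ul] :=
    @choice I F (fun i l => u (f n) i @[n --> \oo] --> l); last by exists l.
  by apply: fl; rewrite mem_enum.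
elim: (enum I) => [|i s [f fi fl]]; first by exists id.
have [g gi [l gl]] :=
  @bounded_scalar_cvg_subseq (fun n => u (f n) i) M (fun n => uM _ _).
exists (f \o g); first exact: increasing_comp.
move=> j; rewrite inE => /predU1P[->|/fl[l' fl']]; first by exists l.
by exists l'; exact: (cvg_subseq _ _ _ _ gi fl').
Qed.

End Compactness.

(** * Frames, their Gram matrices, and their limits *)

Section FrameLimits.
Context {R : realType} {k : scalar_kind}.
Local Notation F := (frame_field R k).

Definition real_scalar : R -> F :=
  match k return R -> frame_field R k with
  | RealScalars => fun r => r
  | ComplexScalars => fun r => r%:C%C
  end.

Lemma modulus_real_scalar (r : R) : 0 <= r -> modulus (real_scalar r) = r.
Proof.
rewrite /real_scalar; case: k => r0; first exact: ger0_norm.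
by rewrite modulus_complexE /= expr0n addr0 sqrtr_sqr ger0_norm.
Qed.

Lemma vnorm_sq (K : nat) (x : 'cV[F]_K) :
  vnorm x ^+ 2 = \sum_(a < K) modulus (x a 0) ^+ 2.
Proof. by rewrite sqr_sqrtr// sumr_ge0// => a _; exact: sqr_ge0. Qed.

(** Since [inner x x] is a function of [vnorm x], the Gram matrix of an
    equal-norm frame has a constant diagonal. *)
Lemma inner_self (K : nat) (x : 'cV[F]_K) :
  inner x x = real_scalar (vnorm x ^+ 2).
Proof.
rewrite vnorm_sq /inner /real_scalar; case: k x => x.
  by apply: eq_bigr => a _ /=; rewrite real_normK ?num_real// expr2.
rewrite [RHS](raddf_sum (real_complex R)); apply: eq_bigr => a _.
rewrite modulus_complexE sqr_sqrtr ?addr_ge0 ?sqr_ge0// /conj_field.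
case: (x a 0) => u v; apply/eqP; rewrite eq_complex /=.
by rewrite mulrN opprK -!expr2 mulrN mulrC addNr !eqxx.
Qed.

Lemma modulus_gramian_diag (N K : nat) (f : 'I_N -> 'cV[F]_K) (j : 'I_N) :
  modulus (gramian f j j) = vnorm (f j) ^+ 2.
Proof. by rewrite mxE inner_self modulus_real_scalar ?sqr_ge0. Qed.

(** The trace [K] is shared equally between the [N] diagonal entries. *)
Lemma gramian_diag (N K : nat) (f : 'I_N -> 'cV[F]_K) (j : 'I_N) :
  gram_set k N K (gramian f) -> equal_norm f -> gramian f j j = K%:R / N%:R.
Proof.
move=> [_ _ trK] fnorm.
have N0 : N%:R != 0 :> F by rewrite pnatr_eq0; case: N j {f trK fnorm} => [[]|].
apply: (mulIf N0); rewrite divfK// -trK /mxtrace mulr_natr.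
rewrite (eq_bigr (fun=> gramian f j j)) ?sumr_const ?card_ord// => l _.
by rewrite !mxE !inner_self (fnorm l j).
Qed.

Lemma modulus_coord_le (K : nat) (x : 'cV[F]_K) (a : 'I_K) :
  modulus (x a 0) <= vnorm x.
Proof.
rewrite -[leLHS]ger0_norm ?modulus_ge0// -sqrtr_sqr ler_wsqrtr//.
by rewrite (bigD1 a)//= lerDl sumr_ge0// => b _; exact: sqr_ge0.
Qed.

Lemma cvg_inner (K : nat) (x y : nat -> 'cV[F]_K) (x0 y0 : 'cV[F]_K) :
  (forall a, x n a 0 @[n --> \oo] --> x0 a 0) ->
  (forall a, y n a 0 @[n --> \oo] --> y0 a 0) ->
  inner (x n) (y n) @[n --> \oo] --> inner x0 y0.
Proof.
move=> xx0 yy0; apply: cvg_fsum => a.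
by apply: cvgM; [exact: xx0 | exact: cvg_conj_field (yy0 a)].
Qed.

Lemma cvg_vnorm_sq (K : nat) (x : nat -> 'cV[F]_K) (x0 : 'cV[F]_K) :
  (forall a, x n a 0 @[n --> \oo] --> x0 a 0) ->
  vnorm (x n) ^+ 2 @[n --> \oo] --> vnorm x0 ^+ 2.
Proof.
move=> xx0; under eq_fun do rewrite vnorm_sq.
rewrite vnorm_sq; apply: cvg_fsum => a.
by apply: cvgM; exact: cvg_modulus (xx0 a).
Qed.

Section FrameSequence.
Variables (N K : nat) (f : nat -> 'I_N -> 'cV[F]_K) (f0 : 'I_N -> 'cV[F]_K).
Context (ff0 : forall j a, f n j a 0 @[n --> \oo] --> f0 j a 0).

(** For each fixed [x] the Parseval identity is an equality between continuous
    functions of the frame. *)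
Lemma parseval_frame_lim :
  (forall n, parseval_frame (f n)) -> parseval_frame f0.
Proof.
move=> fP x; apply: (cvg_unique_eq _ _ _ _ _ (fun n => fP n x)); last first.
  exact: cvg_cst.
apply: cvg_fsum => j.
by apply: cvgM; apply/cvg_modulus/cvg_inner => // a; exact: cvg_cst.
Qed.

Lemma equal_norm_lim : (forall n, equal_norm (f n)) -> equal_norm f0.
Proof.
move=> fe j l; apply: (@pexpIrn _ 2) => //; rewrite ?nnegrE ?sqrtr_ge0//.
have fe2 n : vnorm (f n j) ^+ 2 = vnorm (f n l) ^+ 2 by rewrite (fe n j l).
by apply: (cvg_unique_eq _ _ _ _ _ fe2); exact: cvg_vnorm_sq.
Qed.

Lemma cvg_gramian : gramian (f n) @[n --> \oo] --> gramian f0.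
Proof.
apply: cvg_mx => i j; rewrite mxE.
by under eq_fun do rewrite mxE; exact: cvg_inner.
Qed.

End FrameSequence.

Lemma gram_set_lim (N K : nat) (G : nat -> 'M[F]_N) (G0 : 'M[F]_N) :
  (forall n, gram_set k N K (G n)) -> G @ \oo --> G0 -> gram_set k N K G0.
Proof.
move=> GP GG0.
have cvgG i j : G n i j @[n --> \oo] --> G0 i j.
  apply: (cvg_comp G (fun M : 'M[F]_N => M i j) GG0).
  exact: coord_continuous.
split.
- apply/matrixP => i j.
  apply: (cvg_unique_eq _ _ (fun n => (G n *m G n) i j) _ _ _ (cvgG i j)).
    by move=> n; have [<-] := GP n.
  under eq_fun do rewrite mxE; rewrite mxE.
  by apply: cvg_fsum => l; exact: cvgM.
- apply/matrixP => i j; rewrite /adjoint !mxE.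
  apply: (cvg_unique_eq _ _ _ _ _ _
           (cvgG i j) (cvg_conj_field _ _ (cvgG j i))) => n.
  by have [_ GE _] := GP n; rewrite {1}GE /adjoint !mxE.
- apply: (cvg_unique_eq _ (fun n => \tr (G n)) (fun=> K%:R)); last first.
  + exact: cvg_cst.
  + by apply: cvg_fsum.
  + by move=> n; have [] := GP n.
Qed.

End FrameLimits.

(** * Least coherence of the limit *)

Section Minimality.
Context {R : realType} {k : scalar_kind} {N K : nat}.
Local Notation F := (frame_field R k).
Implicit Types G H : 'M[F]_N.

Lemma modulus_le_coherence G (j l : 'I_N) :
  j != l -> modulus (G j l) <= coherence G.
Proof. by move=> jl; rewrite /coherence (le_bigmax_cond _ _ (j := (j, l))). Qed.

Lemma coherence_ge0 G : 0 <= coherence G.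
Proof. exact: bigmax_ge_id. Qed.

(** The diagonal terms of the two potentials cancel.  A single term bounds the
    remaining sum for [G] from below, and the coherence bounds each of the at
    most [N * N] remaining terms for [H] from above. *)
Lemma sum_potential_entry_le (eta a b : R) G H (j l : 'I_N) :
  0 < eta -> (forall i, G i i = H i i) ->
  sum_potential K eta G <= sum_potential K eta H ->
  j != l -> 0 <= b -> b <= modulus (G j l) -> coherence H <= a ->
  expR (eta * b ^+ 2) <= (N * N)%:R * expR (eta * a ^+ 2).
Proof.
move=> eta0 GH; rewrite /sum_potential.
under [X in _ + X <= _]eq_bigr do rewrite GH.
rewrite lerD2r => GHle jl b0 bG Ha.
apply: (@le_trans _ _ (expR (eta * modulus (G j l) ^+ 2))).
  by rewrite ler_expR ler_pM2l// ler_sqr ?nnegrE// (le_trans b0).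
apply: le_trans (le_trans _ GHle) _.
  rewrite (bigD1 j)//= (bigD1 l)//= -addrA lerDl.
  apply: addr_ge0; apply: sumr_ge0 => ? _; first exact: expR_ge0.
  by apply: sumr_ge0 => ? _; exact: expR_ge0.
rewrite pair_big_dep/=.
apply: (@le_trans _ _ (\sum_(p : 'I_N * 'I_N) expR (eta * a ^+ 2))); last first.
  by rewrite sumr_const card_prod card_ord mulr_natl.
rewrite big_mkcond/=; apply: ler_sum => -[i m] _ /=.
case: ifP => im; last exact: expR_ge0.
have Hle := le_trans (modulus_le_coherence H _ _ im) Ha.
rewrite ler_expR ler_pM2l// ler_sqr ?nnegrE ?modulus_ge0//.
exact: le_trans (modulus_ge0 _) Hle.
Qed.

(** For large [eta] the potential is dominated by the largest off-diagonal
    entries, so a limit of minimizers cannot have an entry larger than the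
    coherence of a competitor with the same diagonal. *)
Lemma coherence_lim_min (eta : nat -> R) (G : nat -> 'M[F]_N) G0 H :
  (forall n, 0 < eta n) -> eta @ \oo --> +oo -> G @ \oo --> G0 ->
  (forall n, sum_potential K (eta n) (G n) <= sum_potential K (eta n) H) ->
  (forall n i, G n i i = H i i) ->
  coherence G0 <= coherence H.
Proof.
move=> eta0 etaoo GG0 Gmin Gdiag; apply: bigmax_le => [|[j l] /= jl].
  exact: coherence_ge0.
rewrite leNgt; apply/negP => Hlt.
set a := coherence H in Hlt; have a0 : 0 <= a := coherence_ge0 H.
pose b := (a + modulus (G0 j l)) / 2.
have [ab bG0] : a < b /\ b < modulus (G0 j l).
  by split; rewrite /b ?midf_lt.
have cvgG : modulus (G n j l) @[n --> \oo] --> modulus (G0 j l).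
  apply: cvg_modulus; apply: (cvg_comp G (fun M : 'M[F]_N => M j l) GG0).
  exact: coord_continuous.
have d0 : 0 < b ^+ 2 - a ^+ 2.
  by rewrite subr_gt0 ltr_sqr ?nnegrE// (le_trans a0 (ltW ab)).
have [n [bn en]] : exists n, b < modulus (G n j l) /\
    (N * N)%:R / (b ^+ 2 - a ^+ 2) < eta n.
  near \oo => n; exists n; split; near: n.
    exact: (cvgr_gt _ cvgG).
  by move/cvgryPgt : etaoo; exact.
(* Through [1 + x <= expR x] at [x := eta n * (b ^+ 2 - a ^+ 2)], the bound
   below contradicts the choice of [n]. *)
have := sum_potential_entry_le _ _ _ _ _ j l (eta0 n) (Gdiag n) (Gmin n) jl
  (le_trans a0 (ltW ab)) (ltW bn) (lexx a).
rewrite -ler_pdivrMr ?expR_gt0// -expRN -expRD -mulrBr.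
move=> /(le_trans (expR_ge1Dx _)); apply/negP; rewrite -ltNge.
by rewrite ltr_pdivrMr// in en; rewrite (lt_le_trans en)// lerDr.
Unshelve. all: by end_near. Qed.

End Minimality.

Theorem proposition4p32 (R : realType) (k : scalar_kind) (N K : nat)
    (hK1 : (1 <= K)%N) (hKN : (K <= N)%N) (hN : (2 <= N)%N)
    (eta : nat -> R) (G : nat -> 'M[frame_field R k]_N)
    (eta_gt0 : forall m, 0 < eta m)
    (eta_incr : nondecreasing_seq eta)
    (eta_lim : eta @ \oo --> +oo)
    (G_min : forall m,
       attains_min (sum_potential K (eta m)) (gram_set k N K) (G m))
    (G_equal_norm : forall m, exists f : 'I_N -> 'cV[frame_field R k]_K,
       [/\ parseval_frame f, equal_norm f & G m = gramian f]) :
  exists (ms : nat -> nat) (G0 : 'M[frame_field R k]_N),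
    [/\ increasing_seq ms,
        gram_set k N K G0,
        (fun s => G (ms s)) @ \oo --> G0 &
        exists f : 'I_N -> 'cV[frame_field R k]_K,
          grassmannian_equal_norm_parseval f /\ G0 = gramian f].
Proof.
have [f fP] := choice G_equal_norm.
have GM m : gram_set k N K (G m) by have [] := G_min m.
have Gdiag m j : G m j j = K%:R / N%:R.
  have := GM m; have [_ fe ->] := fP m; move=> fM.
  exact: gramian_diag.
(* [d] is [K / N], the common squared norm of all the frame vectors. *)
pose d : R := modulus (K%:R / N%:R : frame_field R k).
have fbound m (p : 'I_N * 'I_K) : modulus (f m p.1 p.2 0) <= Num.sqrt d.
  apply: le_trans (modulus_coord_le _ _ _) _; have [_ _ Gf] := fP m.
  rewrite /d -(Gdiag m p.1) Gf modulus_gramian_diag sqrtr_sqr.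
  exact: ler_norm.
have [ms msi [l fl]] := @bounded_family_cvg_subseq _ _ _
  (fun m (p : 'I_N * 'I_K) => f m p.1 p.2 0) _ fbound.
pose f0 (j : 'I_N) : 'cV[frame_field R k]_K := \col_a l (j, a).
have ff0 j a : f (ms s) j a 0 @[s --> \oo] --> f0 j a 0.
  by rewrite mxE; exact: (fl (j, a)).
have GG0 : G (ms s) @[s --> \oo] --> gramian f0.
  have -> : G = fun m => gramian (f m) by apply/funext => m; have [] := fP m.
  exact: (cvg_gramian _ _ (fun s => f (ms s)) _ ff0).
have f0M : gram_set k N K (gramian f0) by apply: gram_set_lim GG0.
have f0e : equal_norm f0.
  by apply: (equal_norm_lim _ _ _ _ ff0) => // s; have [] := fP (ms s).
exists ms, (gramian f0); split=> //; exists f0; split=> //; split=> //.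
  by apply: (parseval_frame_lim _ _ _ _ ff0) => // s; have [] := fP (ms s).
split.
  by exists (gramian f0) => //; split=> // j; exact: gramian_diag.
move=> _ [H [HM Hdiag] <-].
apply: (coherence_lim_min (K := K) (eta \o ms) (fun s => G (ms s))) => //.
- by move=> s; exact: eta_gt0.
- exact: (cvg_comp _ _ (cvg_increasing_seq _ msi) eta_lim).
- by move=> s; have [_] := G_min (ms s); exact.
- by move=> s i; rewrite Gdiag Hdiag.
Qed.
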